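(* Let $m,p\geq 2$ be integers. Then \begin{align*} &S_{1^2m,p}+S_{1^2p,m}+S_{2m,p}+S_{2p,m}\\ &=2(-1)^{p-1}\sum_{i=1}^{p-2}(-1)^{i-1}S_{m,i+1}\, S_{1,p-i}+2(-1)^{m-1}\sum_{i=1}^{m-2}(-1)^{i-1}S_{p,i+1}\, S_{1,m-i}\\ &\quad-2\zeta(2)\big(\zeta(m)\zeta(p)+\zeta(m+p)\big)+2S_{1m,p+1}+2S_{1p,m+1}\\ &\quad+2(-1)^{m+p}S_{1^2,m+p}-2(-1)^{m+p}S_{1,p}\, S_{1,m}\\ &\quad-2(-1)^{p-1}\zeta(m+1)S_{1,p}-2(-1)^{m-1}\zeta(p+1)S_{1,m}\\ &\quad-2(-1)^{p-1}\sum_{j=1}^{m-1}(-1)^{j-1}\zeta(m+1-j)\big(S_{1j,p}-S_{1,p+j}\big)\\ &\quad-2(-1)^{m-1}\sum_{j=1}^{p-1}(-1)^{j-1}\zeta(p+1-j)\big(S_{1j,m}-S_{1,m+j}\big). \end{align*}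
   Context: For positive integers $k$ and $n\ge 0$, $H_n^{(k)}=\sum_{j=1}^n j^{-k}$ (with $H_0^{(k)}=0$) and $H_n=H_n^{(1)}$. For positive integers $s_1,\dots,s_r$ and an integer $q\geq 2$, the Euler sum is $S_{s_1s_2\cdots s_r,q}=\sum_{n=1}^\infty \frac{H_n^{(s_1)}H_n^{(s_2)}\cdots H_n^{(s_r)}}{n^q}$; repeated indices are written as powers, e.g. $S_{1^2m,p}=\sum_{n\ge1}H_n^2H_n^{(m)}/n^p$, $S_{1^2,q}=\sum_{n\ge1} H_n^2/n^q$, and $S_{1j,p}=\sum_{n\ge1}H_nH_n^{(j)}/n^p$ (so $S_{11,p}=S_{1^2,p}$). $\zeta$ is the Riemann zeta function. *)

(* Defs.v *)
From mathcomp Require Import all_boot all_order all_algebra.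
From mathcomp Require Import all_classical all_reals all_analysis.
Import numFieldNormedType.Exports.

Set Implicit Arguments.
Unset Strict Implicit.
Unset Printing Implicit Defensive.

Local Open Scope ring_scope.

Definition harmonic_number (R : realType) (k n : nat) : R :=
  \sum_(1 <= j < n.+1) (j%:R ^+ k)^-1.

(* The index is the list of the s_i with repetitions: S_{1^2 m, p} is
   euler_sum R [:: 1; 1; m] p. The \big[...]_(1 <= n <oo) notation is the limit
   of the real partial sums, meaningful when the series converges (q >= 2). *)
Definition euler_sum (R : realType) (s : seq nat) (q : nat) : R :=
  \big[+%R/0]_(1 <= n <oo)
    ((\prod_(k <- s) harmonic_number R k n) / n%:R ^+ q).

(* The Riemann zeta function at integers k >= 2, where its series converges. *)
Definition zeta (R : realType) (k : nat) : R :=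
  \big[+%R/0]_(1 <= n <oo) ((n%:R ^+ k)^-1 : R).

(* Main.v *)
Require Import Defs.
From mathcomp Require Import all_boot all_order all_algebra.
From mathcomp Require Import all_classical all_reals all_analysis.
From mathcomp Require Import ring lra zify.

(** Summing over [k] first or over [n] first in the nonnegative double series
    [H_n / n * (H_k^(m) / (k^(p-1) (n + k)) + H_k^(p) / (k^(m-1) (n + k)))]
    gives the two sides of the identity.

    Everything rests on the sums [U_n(m) = sum_k H_k^(m) (1/k - 1/(k+n))], in
    which summation by parts yields
    [U_(n+1)(m) - U_n(m) = sum_k 1 / (k^m (k+n))]; partial fractions then
    express [U_n(m)] through zeta values, [H_(n-1)^(j)] and
    [sum_(l < n) H_l / l^m].

    For fixed [k], the sum over [n] is [U_k(1)], which is
    [zeta(2) + (H_k^2 + H_k^(2)) / 2 - H_k / k]: this produces the left-hand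
    side, the terms in [zeta(2)] and [S_{1m,p+1} + S_{1p,m+1}].  For fixed [n],
    partial fractions in [k] reduce the sum to the constants [S_{m,i+1}] and
    [U_n(m)]; the two leftover nested sums combine, by symmetry, into
    [S_{1,p} S_{1,m} - S_{1^2,m+p}]. *)

Import Order.TTheory GRing.Theory Num.Theory.
Import numFieldNormedType.Exports.
Local Open Scope classical_set_scope.
Local Open Scope ring_scope.

Section EulerSums.
Context {R : realType}.
Implicit Types (u v : nat -> R) (k l m n p q r : nat) (a b c : R).

Local Notation H := (harmonic_number R).

(** * Convergent series indexed from 1, and exchange of the order of summation *)

(* The sum starts at [n = 1]; the value [u 0] is ignored. *)
Definition has_sum u a := series (fun n => u n.+1) @ \oo --> a.

Lemma has_sum_eq u v a b : has_sum u a ->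
  (forall n, (0 < n)%N -> u n = v n) -> a = b -> has_sum v b.
Proof.
move=> ua uv <-; rewrite /has_sum (_ : (fun n => v n.+1) = (fun n => u n.+1)) //.
by apply/funext => n; rewrite uv.
Qed.

Lemma has_sumD {u v a b} :
  has_sum u a -> has_sum v b -> has_sum (fun n => u n + v n) (a + b).
Proof.
move=> ua vb; rewrite /has_sum.
have -> : series (fun n => u n.+1 + v n.+1) =
    (fun N => series (fun n => u n.+1) N + series (fun n => v n.+1) N).
  by apply/funext => N; rewrite /series /= big_split.
exact: cvgD.
Qed.

Lemma has_sumZ {u a} c : has_sum u a -> has_sum (fun n => c * u n) (c * a).
Proof.
move=> ua; rewrite /has_sum.
have -> : series (fun n => c * u n.+1) = (fun N => c * series (fun n => u n.+1) N).
  by apply/funext => N; rewrite /series /= mulr_sumr.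
exact: cvgMl_tmp.
Qed.

Lemma has_sumB {u v a b} :
  has_sum u a -> has_sum v b -> has_sum (fun n => u n - v n) (a - b).
Proof.
move=> ua vb; apply: has_sum_eq (has_sumD ua (has_sumZ (-1) vb)) _ _.
  by move=> n _; rewrite mulN1r.
by rewrite mulN1r.
Qed.

Lemma has_sum0 : has_sum (fun=> 0) 0.
Proof.
rewrite /has_sum (_ : series _ = fun=> 0); first exact: cvg_cst.
by apply/funext => N; rewrite /series /= big1.
Qed.

Lemma has_sum_nat s t (f : nat -> nat -> R) (w : nat -> R) :
  (forall j, (s <= j < t)%N -> has_sum (f j) (w j)) ->
  has_sum (fun n => \sum_(s <= j < t) f j n) (\sum_(s <= j < t) w j).
Proof.
elim: t => [_|t IH fw].
  apply: has_sum_eq has_sum0 _ _ => [n _|]; by rewrite big_geq.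
have [st|ts] := leqP s t.
  apply: has_sum_eq (has_sumD (IH _) (fw t _)) _ _.
  - by move=> j /andP[sj jt]; apply: fw; rewrite sj ltnW.
  - by rewrite st /=.
  - by move=> n _; rewrite big_nat_recr.
  - by rewrite big_nat_recr.
by apply: has_sum_eq has_sum0 _ _ => [n _|]; rewrite big_geq.
Qed.

Lemma series_le_has_sum u a N : (forall n, (0 < n)%N -> 0 <= u n) ->
  has_sum u a -> series (fun n => u n.+1) N <= a.
Proof.
move=> u0 ua; rewrite -(cvg_lim _ ua)//; apply: nondecreasing_cvgn_le.
  by apply: (@nondecreasing_series _ _ xpredT 0) => n _ _; apply: u0.
by apply/cvg_ex; exists a.
Qed.

(** Finitely many columns add up to the series over [i] of truncated rows, and by nonnegativity each
    truncated row is at most its full sum [r i]. The exchange equality follows by applying this to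
    [f] and to its transpose. *)
Lemma has_sum_exchange_le (f : nat -> nat -> R) (r c : nat -> R) (a b : R) :
  (forall i j, 0 <= f i j) ->
  (forall i, (0 < i)%N -> has_sum (f i) (r i)) ->
  (forall j, (0 < j)%N -> has_sum (f ^~ j) (c j)) ->
  has_sum r a -> has_sum c b -> b <= a.
Proof.
move=> f0 fr fc ra cb; apply: (cvgr_to_le cb).
apply: nearW => N; rewrite /series /= -[leLHS]/(\sum_(0 <= k < N) c k.+1).
have cN : has_sum (fun i => \sum_(0 <= j < N) f i j.+1) (\sum_(0 <= j < N) c j.+1).
  by apply: has_sum_nat => j _; apply: fc.
apply: (ler_cvg_to cN ra); apply: nearW => M; apply: ler_sum => i _.
by apply: series_le_has_sum => //; apply: fr.
Qed.

Lemma has_sum_exchange (f : nat -> nat -> R) (r c : nat -> R) (a b : R) :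
  (forall i j, 0 <= f i j) ->
  (forall i, (0 < i)%N -> has_sum (f i) (r i)) ->
  (forall j, (0 < j)%N -> has_sum (f ^~ j) (c j)) ->
  has_sum r a -> has_sum c b -> a = b.
Proof.
move=> f0 fr fc ra cb; apply/eqP; rewrite eq_le; apply/andP; split.
  by apply: (has_sum_exchange_le (fun j i => f i j) c r).
by apply: (has_sum_exchange_le f r c).
Qed.

Lemma has_sum_dominated u v C : (forall n, (0 < n)%N -> 0 <= u n <= v n) ->
  (forall N, series (fun n => v n.+1) N <= C) -> exists a, has_sum u a.
Proof.
move=> uv vC.
have : cvgn (series (fun n => u n.+1)).
  apply: nondecreasing_is_cvgn.
    by apply: (@nondecreasing_series _ _ xpredT 0) => n _ _; case/andP: (uv n.+1 isT).
  exists C => _ [N _ <-]; apply: le_trans (vC N); apply: ler_sum => i _.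
  by case/andP: (uv i.+1 isT).
by move/cvg_ex => [a ua]; exists a.
Qed.

Lemma has_sum_limn u a : has_sum u a -> \big[+%R/0]_(1 <= n <oo) u n = a.
Proof.
move=> ua; apply: cvg_lim => //.
rewrite -cvg_shiftS (_ : [sequence _]_n = series (fun n => u n.+1)) //.
by apply/funext => N; rewrite /= big_add1.
Qed.

(** * Growth of harmonic numbers and convergence of Euler sums *)

Lemma harmonic_number0 k : H k 0 = 0.
Proof. by rewrite /harmonic_number big_geq. Qed.

Lemma harmonic_numberS k n : H k n.+1 = H k n + (n.+1%:R ^+ k)^-1.
Proof. by rewrite /harmonic_number big_nat_recr. Qed.

Lemma harmonic_number_ge0 k n : 0 <= H k n.
Proof. by apply: sumr_ge0 => j _; rewrite invr_ge0 exprn_ge0. Qed.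

Lemma harmonic_number_le k n : (0 < k)%N -> H k n <= H 1 n.
Proof.
move=> k0; rewrite /harmonic_number big_nat_cond [leRHS]big_nat_cond.
apply: ler_sum => j /andP[/andP[j0 _] _].
rewrite lef_pV2 ?posrE ?exprn_gt0 ?ltr0n// expr1 ler_eXnr ?ler1n//.
Qed.

(** A discrete mean value estimate: it bounds the increment of a power of [H 1] in the summation by
    parts below. *)
Lemma subrXX_le a b r : 0 <= b <= a ->
  a ^+ r.+1 - b ^+ r.+1 <= r.+1%:R * a ^+ r * (a - b).
Proof.
move=> /andP[b0 ba]; have a0 := le_trans b0 ba.
elim: r => [|r IH]; first by rewrite !expr1 expr0 mulr1 mul1r.
have -> : a ^+ r.+2 - b ^+ r.+2 = a * (a ^+ r.+1 - b ^+ r.+1) + (a - b) * b ^+ r.+1.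
  by rewrite 2!(exprS _ r.+1); ring.
have -> : r.+2%:R * a ^+ r.+1 * (a - b) =
    a * (r.+1%:R * a ^+ r * (a - b)) + (a - b) * a ^+ r.+1.
  by rewrite exprS -[r.+2%:R]natr1; ring.
rewrite lerD// ler_wpM2l ?subr_ge0//.
by rewrite lerXn2r ?nnegrE.
Qed.

(* Summation by parts trades one factor [H 1 n] for a factor [1 / n]. *)
Lemma harmonic_number_pow_bounded r : exists C : R, forall N,
  series (fun n => H 1 n.+1 ^+ r / (n.+1%:R * n.+2%:R)) N <= C.
Proof.
elim: r => [|r [C HC]].
  exists 1 => N.
  have -> : series (fun n => H 1 n.+1 ^+ 0 / (n.+1%:R * n.+2%:R)) N =
      1 - N.+1%:R^-1.
    elim: N => [|N IH]; first by rewrite /series /= big_geq// invr1 subrr.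
    have x0 : 0 < N.+1%:R :> R by rewrite ltr0n.
    rewrite seriesSr IH expr0 -[N.+2%:R]natr1.
    by move: (N.+1%:R : R) x0 => x x0; field; apply/andP; split; apply: lt0r_neq0; lra.
  by rewrite lerBlDr lerDl invr_ge0.
exists (2 * r.+1%:R * C) => N.
(* The boundary term stays on the left so that the induction closes: with [x = N + 1], the new term
   and the new boundary term add up to [H 1 N.+1 ^+ r.+1 / x]. The factor 2 comes from
   [1 / x^2 <= 2 / (x (x + 1))] for [x >= 1]. *)
have : series (fun n => H 1 n.+1 ^+ r.+1 / (n.+1%:R * n.+2%:R)) N
    + H 1 N ^+ r.+1 / N.+1%:R
    <= 2 * r.+1%:R * series (fun n => H 1 n.+1 ^+ r / (n.+1%:R * n.+2%:R)) N.
  elim: N => [|N IH].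
    by rewrite /series /= !big_geq// harmonic_number0 expr0n mul0r mulr0 addr0.
  rewrite 2!seriesSr [leRHS]mulrDr.
  have x1 : 1 <= N.+1%:R :> R by rewrite ler1n.
  have hE := harmonic_numberS 1 N; rewrite expr1 in hE.
  have : 0 <= H 1 N <= H 1 N.+1.
    by rewrite harmonic_number_ge0 hE lerDl invr_ge0 ler0n.
  move=> /(subrXX_le _ _ r); rewrite {3}hE addrAC subrr add0r.
  have hr0 : 0 <= H 1 N.+1 ^+ r by rewrite exprn_ge0// harmonic_number_ge0.
  have r0 : 0 <= r.+1%:R :> R by [].
  rewrite -[N.+2%:R]natr1.
  move: IH hr0 r0.
  set S1 := series _ _; set S2 := series _ _.
  move: S1 S2 (N.+1%:R : R) x1 => S1 S2 x x1.
  move: (H 1 N.+1 ^+ r.+1) (H 1 N ^+ r.+1) (H 1 N.+1 ^+ r) (r.+1%:R : R) => A B E q.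
  move=> IH E0 q0 AB.
  have x0 : 0 < x by lra.
  have x2 : 0 < x + 1 by lra.
  have xn0 : x != 0 by rewrite gt_eqF.
  have x1n0 : x + 1 != 0 by rewrite gt_eqF.
  have -> : S1 + A / (x * (x + 1)) + A / (x + 1) = S1 + B / x + (A - B) / x.
    by field; rewrite xn0.
  apply: lerD => //.
  have /le_trans : (A - B) / x <= q * E / x / x by rewrite ler_pM2r ?invr_gt0.
  apply.
  have -> : q * E / x / x = q * E * (1 / (x * x)) by field.
  have -> : 2 * q * (E / (x * (x + 1))) = q * E * (2 / (x * (x + 1))).
    by field; rewrite x1n0.
  rewrite ler_wpM2l ?mulr_ge0// ler_pdivrMr ?mulr_gt0//.
  rewrite mulrAC ler_pdivlMr ?mulr_gt0//.
  nra.
move=> h; apply: le_trans (le_trans h _).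
  by rewrite lerDl divr_ge0// exprn_ge0// harmonic_number_ge0.
by rewrite ler_wpM2l// mulr_ge0.
Qed.

(** Comparison: every factor [H k n] is at most [H 1 n], and
    [1 / n^q <= 1 / n^2 <= 2 / (n (n + 1))], so the bounded series above dominates up to the factor
    2. The empty list covers the zeta values. *)
Lemma euler_sum_has_sum s q : all (leq 1) s -> (2 <= q)%N ->
  has_sum (fun n => (\prod_(k <- s) H k n) / n%:R ^+ q) (euler_sum R s q).
Proof.
move=> s1 q2; have [C HC] := harmonic_number_pow_bounded (size s).
pose v n : R := 2 * (H 1 n ^+ size s / (n%:R * n.+1%:R)).
have [a ua] : exists a,
    has_sum (fun n => (\prod_(k <- s) H k n) / n%:R ^+ q) a.
  apply: (has_sum_dominated _ v (2 * C)) => [n n0|N]; last first.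
    by rewrite /v /series /= -mulr_sumr ler_wpM2l// (HC N).
  have prod_ge0 t : 0 <= \prod_(k <- t) H k n.
    by apply: prodr_ge0 => k _; apply: harmonic_number_ge0.
  have prod_le : \prod_(k <- s) H k n <= H 1 n ^+ size s.
    elim: s s1 {HC v} => [_|k s IH /= /andP[k0 s1]]; first by rewrite big_nil.
    by rewrite big_cons exprS ler_pM ?harmonic_number_ge0 ?harmonic_number_le ?IH.
  have x1 : 1 <= n%:R :> R by rewrite ler1n.
  rewrite divr_ge0//= /v mulrCA ler_pM ?invr_ge0//.
  rewrite -[n.+1%:R]natr1.
  apply: (@le_trans _ _ (n%:R ^+ 2)^-1).
    by rewrite lef_pV2 ?posrE ?exprn_gt0 ?ltr0n// ler_weXn2l.
  move: (n%:R : R) x1 => x x1.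
  have x0 : 0 < x by lra.
  have x2 : 0 < x + 1 by lra.
  rewrite -[leLHS]mul1r ler_pdivrMr ?exprn_gt0// mulrAC ler_pdivlMr ?mulr_gt0//.
  nra.
by rewrite /euler_sum (has_sum_limn _ _ ua).
Qed.

Lemma euler_sum1_has_sum k q : (0 < k)%N -> (2 <= q)%N ->
  has_sum (fun n => H k n / n%:R ^+ q) (euler_sum R [:: k] q).
Proof.
move=> k0 q2; have s1 : all (leq 1) [:: k] by rewrite /= k0.
by apply: has_sum_eq (euler_sum_has_sum _ q s1 q2) _ _ => // n _; rewrite big_seq1.
Qed.

Lemma zeta_has_sum q : (2 <= q)%N -> has_sum (fun n => (n%:R ^+ q)^-1) (zeta R q).
Proof.
move=> q2; have /(_ isT q2) := @euler_sum_has_sum [::] q.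
move/has_sum_eq; apply => [n _|]; first by rewrite big_nil mul1r.
rewrite /euler_sum /zeta; congr (limn _); apply/funext => N.
by apply: eq_bigr => n _; rewrite big_nil mul1r.
Qed.

(** The quotient is the Cesàro mean of the null sequence [1 / n^k]. It makes the boundary term of
    the later summation by parts vanish. *)
Lemma harmonic_number_mean_cvg0 k : (0 < k)%N ->
  H k n.+1 / n.+1%:R @[n --> \oo] --> (0 : R).
Proof.
move=> k0.
have u0 : (fun n => (n.+1%:R ^+ k)^-1 : R) @ \oo --> (0 : R).
  apply: squeeze_cvgr (cvg_cst _) (@cvg_harmonic R); apply: nearW => n.
  rewrite invr_ge0 exprn_ge0//= lef_pV2 ?posrE ?exprn_gt0 ?ltr0n//.
  by rewrite ler_eXnr// ler1n.
apply: cvg_trans (cesaro u0); apply: near_eq_cvg; apply: nearW => n.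
by rewrite /arithmetic_mean /= /series /= /harmonic_number mulrC [in RHS]big_add1.
Qed.

(** * Partial fractions, summation by parts and the sums [U_n(m)] *)

Lemma has_sum_remainder u (w : nat -> R) a :
  (forall N, series (fun n => u n.+1) N = a - w N) ->
  w @ \oo --> (0 : R) -> has_sum u a.
Proof.
move=> uw w0; rewrite /has_sum.
rewrite (_ : series _ = fun N => a - w N); last exact/funext.
by rewrite -[X in _ --> X]subr0; apply: cvgB => //; apply: cvg_cst.
Qed.

Lemma shifted_telescope_has_sum l :
  has_sum (fun k => (k + l)%:R^-1 - (k + l.+1)%:R^-1) (l.+1%:R^-1 : R).
Proof.
apply: (has_sum_remainder _ (fun N => (N + l.+1)%:R^-1)).
  elim=> [|N IH]; first by rewrite /series /= big_geq// add0n subrr.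
  by rewrite seriesSr IH addSnnS addrA subrK.
apply: squeeze_cvgr (cvg_cst _) (@cvg_harmonic R); apply: nearW => N.
by rewrite invr_ge0 ler0n/= lef_pV2 ?posrE ?ltr0n ?addnS// ler_nat ltnS leq_addr.
Qed.

Lemma shifted_difference_has_sum l :
  has_sum (fun k => k%:R^-1 - (k + l)%:R^-1) (H 1 l).
Proof.
elim: l => [|l IH].
  apply: has_sum_eq has_sum0 _ _ => [n _|]; last by rewrite harmonic_number0.
  by rewrite addn0 subrr.
apply: has_sum_eq (has_sumD IH (shifted_telescope_has_sum l)) _ _ => [n _|].
  by rewrite addrA subrK.
by rewrite harmonic_numberS expr1.
Qed.

(** Induction on [q] through [1 / (k^(q+2) (k+n)) = (1 / k^(q+2) - 1 / (k^(q+1) (k+n))) / n]. The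
    weight [f] is used twice: [f = 1] gives the increments of [U_n(m)], and [f = H m] gives the rows
    of the double series. *)
Lemma has_sum_partial_fraction (f s : nat -> R) n q b : (0 < n)%N ->
  (forall j, (2 <= j)%N -> has_sum (fun k => f k / k%:R ^+ j) (s j)) ->
  has_sum (fun k => f k * (k%:R^-1 - (k + n)%:R^-1)) b ->
  has_sum (fun k => f k / (k%:R ^+ q.+1 * (k + n)%:R))
    (\sum_(1 <= j < q.+1) (-1) ^+ (j - 1) * s (q.+2 - j)%N / n%:R ^+ j
     + (-1) ^+ q * b / n%:R ^+ q.+1).
Proof.
move=> n0 fs fb; have nn0 : n%:R != 0 :> R by rewrite pnatr_eq0 -lt0n.
have kn0 k : (0 < k)%N -> k%:R != 0 :> R by rewrite pnatr_eq0 -lt0n.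
have knn0 k : k%:R + n%:R != 0 :> R.
  by rewrite -natrD pnatr_eq0 addn_eq0 negb_and -!lt0n n0 orbT.
elim: q => [|q IH].
  apply: has_sum_eq (has_sumZ n%:R^-1 fb) _ _ => [k /kn0 k0|].
    by rewrite natrD expr1; field; rewrite k0 nn0 knn0.
  by rewrite big_geq// add0r expr0 mul1r expr1 mulrC.
apply: has_sum_eq (has_sumZ n%:R^-1 (has_sumB (fs q.+2 isT) IH)) _ _.
  move=> k /kn0 k0; rewrite natrD !exprS; field.
  by rewrite nn0 k0 knn0 expf_neq0.
rewrite [in RHS]big_nat_recl//.
rewrite subnn expr0 mul1r subn1 expr1 mulrBr mulrDr opprD addrA.
congr (_ + _ + _); first by rewrite mulrC.
- rewrite mulr_sumr -sumrN; apply: eq_big_nat => -[//|j] _.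
  rewrite !subSS !subn0 !exprS; field.
  by rewrite nn0 expf_neq0.
- rewrite !exprS; field.
  by rewrite nn0 expf_neq0.
Qed.

Lemma zeta_partial_fraction n m : (0 < n)%N -> (0 < m)%N ->
  has_sum (fun k => (k%:R ^+ m)^-1 / (k + n)%:R)
    (\sum_(1 <= j < m) (-1) ^+ (j - 1) * zeta R (m + 1 - j) / n%:R ^+ j
     + (-1) ^+ (m - 1) * H 1 n / n%:R ^+ m).
Proof.
case: m => // m n0 _.
have fb : has_sum (fun k => 1 * (k%:R^-1 - (k + n)%:R^-1)) (H 1 n).
  by apply: has_sum_eq (shifted_difference_has_sum n) _ _ => // k _; rewrite mul1r.
have fs j : (2 <= j)%N -> has_sum (fun k => 1 / k%:R ^+ j) (zeta R j).
  by move=> j2; apply: has_sum_eq (zeta_has_sum j j2) _ _ => // k _; rewrite mul1r.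
apply: has_sum_eq (has_sum_partial_fraction (fun=> 1) _ n m _ n0 fs fb) _ _.
  by move=> k _; rewrite mul1r invfM.
by rewrite subn1 addn1.
Qed.

(* Summation by parts. *)
Lemma harmonic_number_difference_has_sum m n b : (0 < m)%N ->
  has_sum (fun k => (k%:R ^+ m)^-1 / (k + n)%:R) b ->
  has_sum (fun k => H m k * ((k + n)%:R^-1 - (k + n.+1)%:R^-1)) b.
Proof.
move=> m0 hb.
(* This boundary term is at most the mean [H m N.+1 / N.+1], which tends to 0. *)
have w0 : H m N / (N + n.+1)%:R @[N --> \oo] --> (0 : R).
  apply: squeeze_cvgr (cvg_cst _) (harmonic_number_mean_cvg0 m m0).
  apply: nearW => N; rewrite divr_ge0 ?harmonic_number_ge0//=.
  apply: ler_pM; rewrite ?harmonic_number_ge0 ?invr_ge0//.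
    by rewrite harmonic_numberS lerDl invr_ge0 exprn_ge0.
  by rewrite lef_pV2 ?posrE ?ltr0n ?addnS// ler_nat ltnS leq_addr.
rewrite /has_sum (_ : series _ = fun N =>
    series (fun k => (k.+1%:R ^+ m)^-1 / (k.+1 + n)%:R) N - H m N / (N + n.+1)%:R).
  by rewrite -[X in _ --> X]subr0; apply: cvgB.
apply/funext; elim => [|N IH].
  by rewrite /series /= !big_geq// harmonic_number0 mul0r subr0.
by rewrite 2!seriesSr IH harmonic_numberS addSnnS; ring.
Qed.

(** The closed form of [U_(n+1)(m)]; with this shift both inner sums stop at [n]. *)
Definition harmonic_difference_sum m n : R :=
  zeta R (m + 1) + \sum_(1 <= j < m) (-1) ^+ (j - 1) * zeta R (m + 1 - j) * H j n
  + (-1) ^+ (m - 1) * \sum_(1 <= l < n.+1) H 1 l / l%:R ^+ m.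

(** Induction on [n]: summation by parts at shift 0 gives [U_1(m) = zeta(m+1)], and each further
    increment is evaluated by [zeta_partial_fraction]. *)
Lemma harmonic_difference_sumP m n : (0 < m)%N ->
  has_sum (fun k => H m k * (k%:R^-1 - (k + n.+1)%:R^-1))
    (harmonic_difference_sum m n).
Proof.
move=> m0; elim: n => [|n IH].
  have h : has_sum (fun k => (k%:R ^+ m)^-1 / (k + 0)%:R) (zeta R (m + 1)).
    have m2 : (2 <= m + 1)%N by rewrite addn1.
    apply: has_sum_eq (zeta_has_sum _ m2) _ _ => // k _.
    by rewrite addn0 addn1 exprSr invfM.
  apply: has_sum_eq (harmonic_number_difference_has_sum m 0 _ m0 h) _ _ => [k _|].
    by rewrite addn0.
  rewrite /harmonic_difference_sum [\sum_(1 <= l < 1) _]big_geq// mulr0 addr0.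
  by rewrite big1 ?addr0// => j _; rewrite harmonic_number0 mulr0.
have h := zeta_partial_fraction n.+1 m isT m0.
apply: has_sum_eq (has_sumD IH (harmonic_number_difference_has_sum m n.+1 _ m0 h)) _ _.
  by move=> k _; rewrite -mulrDr addrA subrK.
rewrite /harmonic_difference_sum.
rewrite [\sum_(1 <= l < n.+2) _]big_nat_recr//=.
under [in RHS]eq_bigr => j _ do rewrite harmonic_numberS mulrDr.
by rewrite big_split /=; ring.
Qed.

(** The square of index pairs splits into its two open triangles and its diagonal, for every partial
    sum; [c] is the diagonal. *)
Lemma has_sumM u v a b c : has_sum u a -> has_sum v b ->
  has_sum (fun n => u n * v n) c ->
  has_sum (fun n => u n * (\sum_(1 <= l < n) v l) + v n * (\sum_(1 <= l < n) u l))
    (a * b - c).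
Proof.
move=> ua vb uvc; rewrite /has_sum (_ : series _ = fun N =>
    series (fun n => u n.+1) N * series (fun n => v n.+1) N
    - series (fun n => u n.+1 * v n.+1) N).
  by apply: cvgB => //; apply: cvgM.
apply/funext; elim => [|N IH]; first by rewrite /series /= !big_geq// mul0r subr0.
by rewrite 4!seriesSr IH !big_add1 /series /=; ring.
Qed.

(** The sum of [H 1 l / l] for [l <= n] is half of [H 1 n ^+ 2 + H 2 n]. Here it is written at
    [n.+1], the index of the column, at the cost of removing the last term. *)
Lemma harmonic_difference_sum1 n : harmonic_difference_sum 1 n =
  zeta R 2 + (H 1 n.+1 ^+ 2 + H 2 n.+1) / 2 - H 1 n.+1 / n.+1%:R.
Proof.
rewrite /harmonic_difference_sum addn1 [\sum_(1 <= j < 1) _]big_geq// addr0.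
rewrite subnn expr0 mul1r -addrA; congr (_ + _).
elim: n => [|n IH].
  by rewrite big_geq// !harmonic_numberS !harmonic_number0 !expr1n; field.
rewrite big_nat_recr//= {}IH !harmonic_numberS !expr1; move: (H 1 n) (H 2 n) => x y.
have n0 : n.+1%:R != 0 :> R by rewrite pnatr_eq0.
have n1 : n.+2%:R != 0 :> R by rewrite pnatr_eq0.
by move: (n.+1%:R : R) (n.+2%:R : R) n0 n1 => z t z0 t0; field; rewrite t0.
Qed.

(** * Columns and rows of the double series *)

Lemma harmonic_column_has_sum k : (0 < k)%N ->
  has_sum (fun n => H 1 n / n%:R / (k + n)%:R)
    ((zeta R 2 + (H 1 k ^+ 2 + H 2 k) / 2 - H 1 k / k%:R) / k%:R).
Proof.
case: k => // k _; rewrite -harmonic_difference_sum1.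
(* Partial fractions in [n]: [1 / (n (n+k)) = (1/n - 1/(n+k)) / k]. *)
apply: has_sum_eq (has_sumZ k.+1%:R^-1 (harmonic_difference_sumP 1 k isT)) _ _;
  last by rewrite mulrC.
move=> n n0.
have kn0 : k.+1%:R != 0 :> R by rewrite pnatr_eq0.
have nn0 : n%:R != 0 :> R by rewrite pnatr_eq0 -lt0n.
have : n%:R + k.+1%:R != 0 :> R by rewrite -natrD pnatr_eq0 addnS.
rewrite [(k.+1 + n)%N]addnC natrD; move: (k.+1%:R : R) kn0 => x x0 nx0.
by field; rewrite nn0 x0 nx0.
Qed.

(** The outcome of the partial fraction lemma with [q = p - 2], whence the sign [(-1) ^+ p]; the
    predecessor of [n] undoes the shift in [harmonic_difference_sum]. *)
Definition harmonic_row_sum m p n : R :=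
  \sum_(1 <= j < p - 1) (-1) ^+ (j - 1) * euler_sum R [:: m] (p - j) / n%:R ^+ j
  + (-1) ^+ p * harmonic_difference_sum m n.-1 / n%:R ^+ (p - 1).

Lemma harmonic_row_has_sum m p n : (0 < m)%N -> (2 <= p)%N -> (0 < n)%N ->
  has_sum (fun k => H m k / (k%:R ^+ (p - 1) * (k + n)%:R)) (harmonic_row_sum m p n).
Proof.
case: p => [//|[//|p]] m0 _; case: n => // n _.
have fs j := euler_sum1_has_sum m j m0.
have fb : has_sum (fun k => H m k * _) _ := harmonic_difference_sumP m n m0.
rewrite /harmonic_row_sum.
apply: has_sum_eq (has_sum_partial_fraction (H m) _ n.+1 p _ isT fs fb) _ _.
  by move=> k _; rewrite subn1.
by rewrite subn1 2!(exprS (-1) _) !mulN1r opprK.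
Qed.

(** The subtracted term is the nested sum inside [U_n(m)]. It is set aside because it is evaluated
    only together with its mirror image under swapping [m] and [p]. *)
Lemma harmonic_row_sum_has_sum m p : (2 <= m)%N -> (2 <= p)%N ->
  has_sum (fun n => H 1 n / n%:R * harmonic_row_sum m p n
      - (-1) ^+ p * (-1) ^+ (m - 1) *
        (H 1 n / n%:R ^+ p * \sum_(1 <= l < n) H 1 l / l%:R ^+ m))
    (\sum_(1 <= j < p - 1) (-1) ^+ (j - 1) * euler_sum R [:: m] (p - j)
        * euler_sum R [:: 1%N] (j + 1)
     + (-1) ^+ p * (zeta R (m + 1) * euler_sum R [:: 1%N] p
       + \sum_(1 <= j < m) (-1) ^+ (j - 1) * zeta R (m + 1 - j) *
         (euler_sum R [:: 1; j]%N p - euler_sum R [:: 1%N] (p + j)))).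
Proof.
move=> m2 p2.
have S1j j q : (0 < j)%N -> (2 <= q)%N ->
    has_sum (fun n => H 1 n * H j n / n%:R ^+ q) (euler_sum R [:: 1; j]%N q).
  move=> j0 q2; have s1 : all (leq 1) [:: 1; j]%N by rewrite /= j0.
  apply: has_sum_eq (euler_sum_has_sum _ q s1 q2) _ _ => // n _.
  by rewrite big_cons big_seq1.
have A : has_sum (fun n => \sum_(1 <= j < p - 1) (-1) ^+ (j - 1) *
     euler_sum R [:: m] (p - j) * (H 1 n / n%:R ^+ (j + 1)))
   (\sum_(1 <= j < p - 1) (-1) ^+ (j - 1) * euler_sum R [:: m] (p - j)
        * euler_sum R [:: 1%N] (j + 1)).
  apply: has_sum_nat => j /andP[j1 _]; apply: has_sumZ.
  by apply: euler_sum1_has_sum => //; rewrite addn1.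
have B : has_sum (fun n => \sum_(1 <= j < m) (-1) ^+ (j - 1) * zeta R (m + 1 - j) *
         (H 1 n * H j n / n%:R ^+ p - H 1 n / n%:R ^+ (p + j)))
   (\sum_(1 <= j < m) (-1) ^+ (j - 1) * zeta R (m + 1 - j) *
         (euler_sum R [:: 1; j]%N p - euler_sum R [:: 1%N] (p + j))).
  apply: has_sum_nat => j /andP[j1 _]; apply: has_sumZ; apply: has_sumB; first exact: S1j.
  by apply: euler_sum1_has_sum => //; apply: leq_trans p2 (leq_addr _ _).
apply: has_sum_eq (has_sumD A (has_sumZ ((-1) ^+ p)
  (has_sumD (has_sumZ (zeta R (m + 1)) (euler_sum1_has_sum 1 p isT p2)) B))) _ _ => // n.
case: n => // n _; rewrite /harmonic_row_sum /harmonic_difference_sum /=.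
have n0 : n.+1%:R != 0 :> R by rewrite pnatr_eq0.
have -> : n.+1%:R ^+ p = n.+1%:R * n.+1%:R ^+ (p - 1) :> R.
  by rewrite -exprS subn1 prednK// ltnW.
set Q := \sum_(1 <= l < n.+1) _.
have -> : \sum_(1 <= j < p - 1) (-1) ^+ (j - 1) *
     euler_sum R [:: m] (p - j) * (H 1 n.+1 / n.+1%:R ^+ (j + 1)) =
   H 1 n.+1 / n.+1%:R * \sum_(1 <= j < p - 1)
     (-1) ^+ (j - 1) * euler_sum R [:: m] (p - j) / n.+1%:R ^+ j.
  rewrite mulr_sumr; apply: eq_bigr => j _; rewrite addn1 exprS.
  move: (n.+1%:R : R) n0 => x x0; field.
  by rewrite x0 expf_neq0.
(* [U_n(m)] contains [H j] at the predecessor of the row index; restoring the missing term [1 / n^j]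
   is what produces [S_{1,p+j}]. *)
have -> : \sum_(1 <= j < m) (-1) ^+ (j - 1) * zeta R (m + 1 - j) *
   (H 1 n.+1 * H j n.+1 / (n.+1%:R * n.+1%:R ^+ (p - 1))
     - H 1 n.+1 / n.+1%:R ^+ (p + j)) =
   H 1 n.+1 / (n.+1%:R * n.+1%:R ^+ (p - 1)) *
   \sum_(1 <= j < m) (-1) ^+ (j - 1) * zeta R (m + 1 - j) * H j n.
  rewrite mulr_sumr; apply: eq_bigr => j _; rewrite (harmonic_numberS j) exprD.
  have -> : n.+1%:R ^+ p = n.+1%:R * n.+1%:R ^+ (p - 1) :> R.
    by rewrite -exprS subn1 prednK// ltnW.
  move: (H 1 n.+1) (n.+1%:R : R) n0 => h x x0; field.
  by rewrite x0 !expf_neq0.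
set X := \sum_(1 <= j < p - 1) _; set Y := \sum_(1 <= j < m) _.
move: X Y Q (H 1 n.+1) (n.+1%:R : R) n0 => X Y Q h x x0; field.
by rewrite x0 expf_neq0.
Qed.

Lemma euler_sum_symmetric m p : (2 <= m)%N -> (2 <= p)%N ->
  has_sum (fun k => H m k / k%:R ^+ p + H p k / k%:R ^+ m)
    (zeta R m * zeta R p + zeta R (m + p)).
Proof.
move=> m2 p2; have mp2 : (2 <= m + p)%N by apply: leq_trans m2 (leq_addr _ _).
have zmp : has_sum (fun n => (n%:R ^+ m)^-1 * (n%:R ^+ p)^-1) (zeta R (m + p)).
  by apply: has_sum_eq (zeta_has_sum _ mp2) _ _ => // n _; rewrite exprD invfM.
have zM := has_sumM _ _ _ _ _ (zeta_has_sum _ m2) (zeta_has_sum _ p2) zmp.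
(* The two open triangles give [zeta(m) zeta(p) - zeta(m+p)]. Each of the two harmonic numbers
   includes its endpoint, so the diagonal is added back twice. *)
apply: has_sum_eq (has_sumD zM (has_sumZ 2 zmp)) _ _; last by ring.
case=> // k _; rewrite -/(harmonic_number R m k) -/(harmonic_number R p k).
by rewrite !harmonic_numberS; ring.
Qed.

Lemma sign_pred n : (0 < n)%N -> (-1) ^+ (n - 1) = - (-1) ^+ n :> R.
Proof. by case: n => // n _; rewrite subn1 exprS mulN1r opprK. Qed.

(** The substitution [j = p - 1 - i] turns the order produced by partial fractions into the one of
    the theorem, with an overall sign. *)
Lemma sign_sum_rev p (F G : nat -> R) :
  \sum_(1 <= j < p - 1) (-1) ^+ (j - 1) * F (p - j)%N * G (j + 1)%N =
  (-1) ^+ (p - 1) *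
    \sum_(1 <= i < p - 1) (-1) ^+ (i - 1) * F (i + 1)%N * G (p - i)%N.
Proof.
rewrite mulr_sumr big_nat_rev; apply: eq_big_nat => i /andP[i1 ip] /=.
have -> : (1 + (p - 1) - i.+1 - 1 = p - 2 - i)%N by lia.
have -> : (p - (1 + (p - 1) - i.+1) = i + 1)%N by lia.
have -> : (1 + (p - 1) - i.+1 + 1 = p - i)%N by lia.
have -> : (p - 1 = (p - 2 - i) + 2 + (i - 1))%N by lia.
rewrite 2!exprD sqrrN expr1n mulr1 !mulrA; congr (_ * _ * _).
by rewrite -mulrA -expr2 sqrr_sign mulr1.
Qed.

End EulerSums.

(** * Assembly of the identity from the two orders of summation *)

Theorem theorem2p1 (R : realType) (m p : nat)
    (hm : (2 <= m)%N) (hp : (2 <= p)%N) :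
  let S := euler_sum R in
  let z := zeta R in
  S [:: 1; 1; m]%N p + S [:: 1; 1; p]%N m + S [:: 2; m]%N p + S [:: 2; p]%N m
  = 2 * (-1) ^+ (p - 1) *
      (\sum_(1 <= i < p - 1)
         (-1) ^+ (i - 1) * S [:: m] (i + 1)%N * S [:: 1%N] (p - i)%N)
    + 2 * (-1) ^+ (m - 1) *
      (\sum_(1 <= i < m - 1)
         (-1) ^+ (i - 1) * S [:: p] (i + 1)%N * S [:: 1%N] (m - i)%N)
    - 2 * z 2%N * (z m * z p + z (m + p)%N)
    + 2 * S [:: 1; m]%N (p + 1)%N + 2 * S [:: 1; p]%N (m + 1)%N
    + 2 * (-1) ^+ (m + p) * S [:: 1; 1]%N (m + p)%N
    - 2 * (-1) ^+ (m + p) * S [:: 1%N] p * S [:: 1%N] m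
    - 2 * (-1) ^+ (p - 1) * z (m + 1)%N * S [:: 1%N] p
    - 2 * (-1) ^+ (m - 1) * z (p + 1)%N * S [:: 1%N] m
    - 2 * (-1) ^+ (p - 1) *
      (\sum_(1 <= j < m)
         (-1) ^+ (j - 1) * z (m + 1 - j)%N *
         (S [:: 1; j]%N p - S [:: 1%N] (p + j)%N))
    - 2 * (-1) ^+ (m - 1) *
      (\sum_(1 <= j < p)
         (-1) ^+ (j - 1) * z (p + 1 - j)%N *
         (S [:: 1; j]%N m - S [:: 1%N] (m + j)%N)).
Proof.
move=> S z.
have m0 : (0 < m)%N by apply: ltnW.
have p0 : (0 < p)%N by apply: ltnW.
pose H := harmonic_number R.
pose f n k : R := H 1%N n / n%:R * (H m k / (k%:R ^+ (p - 1) * (k + n)%:R)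
  + H p k / (k%:R ^+ (m - 1) * (k + n)%:R)).
pose row n := H 1%N n / n%:R * (harmonic_row_sum m p n + harmonic_row_sum p m n).
pose c k := H m k / k%:R ^+ p + H p k / k%:R ^+ m.
pose col k := c k * (z 2%N + (H 1%N k ^+ 2 + H 2%N k) / 2 - H 1%N k / k%:R).
have f0 n k : 0 <= f n k.
  by rewrite mulr_ge0 ?addr_ge0 ?divr_ge0 ?mulr_ge0 ?exprn_ge0 ?harmonic_number_ge0.
have frow n : (0 < n)%N -> has_sum (f n) (row n).
  by move=> n0; apply: has_sumZ; apply: has_sumD; apply: harmonic_row_has_sum.
have fcol k : (0 < k)%N -> has_sum (f ^~ k) (col k).
  move=> k0; have kn0 : k%:R != 0 :> R by rewrite pnatr_eq0 -lt0n.
  (* The weight of column [k] is [H m k / k^(p-1) + H p k / k^(m-1)], that is [k * c k]; its [k]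
     cancels the [1 / k] of the column sum. *)
  apply: has_sum_eq (has_sumZ (k%:R * c k) (harmonic_column_has_sum k k0)) _ _.
    move=> n n0; rewrite /f /c /H.
    have -> : k%:R ^+ p = k%:R * k%:R ^+ (p - 1) :> R by rewrite -exprS subn1 prednK.
    have -> : k%:R ^+ m = k%:R * k%:R ^+ (m - 1) :> R by rewrite -exprS subn1 prednK.
    have nn0 : n%:R != 0 :> R by rewrite pnatr_eq0 -lt0n.
    have : (k + n)%:R != 0 :> R by rewrite pnatr_eq0 addn_eq0 negb_and -!lt0n n0 orbT.
    move: ((k + n)%:R : R) => x x0; field.
    by rewrite nn0 kn0 x0 !expf_neq0.
  rewrite /col /H /z; field.
  by rewrite kn0.
have SP s q : all (leq 1) s -> (2 <= q)%N ->
    has_sum (fun n => (\prod_(k <- s) H k n) / n%:R ^+ q) (S s q).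
  exact: euler_sum_has_sum.
have p1 : (2 <= p + 1)%N by rewrite addn1.
have m1 : (2 <= m + 1)%N by rewrite addn1.
have mp2 : (2 <= m + p)%N by apply: leq_trans hm (leq_addr _ _).
have col_sum : has_sum col
    (z 2%N * (z m * z p + z (m + p)%N)
     + 2^-1 * (S [:: 1; 1; m]%N p + S [:: 1; 1; p]%N m
               + S [:: 2; m]%N p + S [:: 2; p]%N m)
     - (S [:: 1; m]%N (p + 1)%N + S [:: 1; p]%N (m + 1)%N)).
  have sm : all (leq 1) [:: 1; m]%N by rewrite /= m0.
  have sp : all (leq 1) [:: 1; p]%N by rewrite /= p0.
  have A := has_sumD (has_sumD (has_sumD (SP [:: 1; 1; m]%N p sm hp)
    (SP [:: 1; 1; p]%N m sp hm)) (SP [:: 2; m]%N p sm hp)) (SP [:: 2; p]%N m sp hm).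
  have B := has_sumD (SP _ _ sm p1) (SP _ _ sp m1).
  apply: has_sum_eq (has_sumB (has_sumD (has_sumZ (z 2%N) (euler_sum_symmetric m p hm hp))
    (has_sumZ 2^-1 A)) B) _ _ => // k k0.
  rewrite !big_cons !big_nil /col /c /H !addn1 !exprS.
  have kn0 : k%:R != 0 :> R by rewrite pnatr_eq0 -lt0n.
  by field; rewrite kn0 !expf_neq0.
have row_sum : has_sum row
    ((-1) ^+ (p - 1) * (\sum_(1 <= i < p - 1)
         (-1) ^+ (i - 1) * S [:: m] (i + 1)%N * S [:: 1%N] (p - i)%N)
     + (-1) ^+ p * (z (m + 1)%N * S [:: 1%N] p + \sum_(1 <= j < m)
         (-1) ^+ (j - 1) * z (m + 1 - j)%N *
         (S [:: 1; j]%N p - S [:: 1%N] (p + j)%N))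
     + ((-1) ^+ (m - 1) * (\sum_(1 <= i < m - 1)
         (-1) ^+ (i - 1) * S [:: p] (i + 1)%N * S [:: 1%N] (m - i)%N)
     + (-1) ^+ m * (z (p + 1)%N * S [:: 1%N] m + \sum_(1 <= j < p)
         (-1) ^+ (j - 1) * z (p + 1 - j)%N *
         (S [:: 1; j]%N m - S [:: 1%N] (m + j)%N)))
     - (-1) ^+ m * (-1) ^+ p * (S [:: 1%N] p * S [:: 1%N] m - S [:: 1; 1]%N (m + p)%N)).
  have S11 : has_sum (fun n => H 1%N n / n%:R ^+ p * (H 1%N n / n%:R ^+ m))
      (S [:: 1; 1]%N (m + p)%N).
    apply: has_sum_eq (SP [:: 1; 1]%N _ isT mp2) _ _ => // n _.
    by rewrite big_cons big_seq1 exprD invfM; ring.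
  (* Both leftover nested sums carry the sign [- (-1)^(m+p)], so they combine into the two open
     triangles of [S_{1,p} S_{1,m}], whose diagonal is [S_{1^2,m+p}]. *)
  have P := has_sumM _ _ _ _ _ 
    (euler_sum1_has_sum 1 p isT hp) (euler_sum1_has_sum 1 m isT hm) S11.
  have A := @harmonic_row_sum_has_sum R m p hm hp.
  have B := @harmonic_row_sum_has_sum R p m hp hm.
  apply: has_sum_eq (has_sumB (has_sumD A B) (has_sumZ ((-1) ^+ m * (-1) ^+ p) P)) _ _.
    by move=> n n0; rewrite /row /H !sign_pred//; ring.
  rewrite (sign_sum_rev p (S [:: m]) (S [:: 1%N])).
  by rewrite (sign_sum_rev m (S [:: p]) (S [:: 1%N])).
have E := has_sum_exchange f row col _ _ f0 frow fcol row_sum col_sum.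
(* The theorem is twice [E], solved for the four sums of weight one half. Once every sign is written
   with [(-1) ^+ m] and [(-1) ^+ p], this is linear in the remaining monomials. *)
move: E; rewrite !sign_pred// exprD.
lra.
Qed.
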